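(* Let $n\ge1$. The class of $(\langle\ \rangle;,\mathsf A_1,\dots,\mathsf A_n,\mathsf F_1,\dots,\mathsf F_n,\sqcup)$-algebras that are representable by injective $n$-ary partial functions is a quasivariety, finitely axiomatised by the following (quasi)equations (each universally quantified over all element variables occurring in it): (1) $\langle \boldsymbol a; b_1,\dots,\boldsymbol a; b_n\rangle ; c = \boldsymbol a;(\boldsymbol b; c)$; (2) $\boldsymbol\pi; a = a$; (3) $\langle \mathsf A_1^n a\rangle; a = 0$ (i.e. $\langle \mathsf A_1^n a\rangle; a=\langle \mathsf A_1^n b\rangle; b$ for all $a,b$, so that $0$ is a well-defined constant); (4) $\langle a_1,\dots,a_{i-1},0,a_{i+1},\dots,a_n\rangle; b = 0$ for every $i$; (5) $\boldsymbol a; 0 = 0$; (6) $\boldsymbol a;\mathsf A_i b = \langle \mathsf A_1^n(\boldsymbol a; b)\rangle;\langle \mathsf D_1^n a_1\rangle;\cdots;\langle \mathsf D_1^n a_n\rangle; a_i$ for every $i$; (7) $\langle \mathsf D_1^n a\rangle; b=\langle \mathsf D_1^n a\rangle; c \ \wedge\ \langle \mathsf A_1^n a\rangle; b=\langle \mathsf A_1^n a\rangle; c \ \rightarrow\ b=c$; (8) $\langle \mathsf D_1^n a\rangle; a = a$; (9) $\mathsf A_i\mathsf A_j a=\mathsf A_i\mathsf A_k a$ for every $i,j,k$; (10) $\boldsymbol b; a=\boldsymbol c; a\ \rightarrow\ \boldsymbol b;\mathsf D_i a=\boldsymbol c;\mathsf D_i a$ for every $i$; (11) $\langle \mathsf D_1^n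 a\rangle;(a\sqcup b)=a$; (12) $\langle \mathsf A_1^n a\rangle;(a\sqcup b)=\langle \mathsf A_1^n a\rangle; b$; (13) $\mathsf D_i(\mathsf F_i a)=\mathsf F_i a$ for every $i$; (14) $\langle \mathsf D_1^n(\mathsf F_i a)\rangle; a=\mathsf F_i a$ for every $i$; (15) $\boldsymbol b; a=b_i\ \rightarrow\ \boldsymbol b;\mathsf F_i a=b_i$ for every $i$.
   Context: Fix $n\ge 1$; indices $i,j,k$ range over $\{1,\dots,n\}$. The signature has an $(n+1)$-ary operation (composition), written $\langle a_1,\dots,a_n\rangle ; b$, unary operations $\mathsf A_1,\dots,\mathsf A_n,\mathsf F_1,\dots,\mathsf F_n$, and a binary operation $\sqcup$. Algebras are nonempty. An $n$-ary partial function on a set $X$ is a set $f\subseteq X^{n+1}$ such that $(\boldsymbol x,y),(\boldsymbol x,z)\in f$ implies $y=z$ (where $\boldsymbol x\in X^n$); it is injective if $(\boldsymbol x,z),(\boldsymbol y,z)\in f$ implies $\boldsymbol x=\boldsymbol y$. An algebra of $n$-ary partial functions of this signature is an algebra whose elements are $n$-ary partial functions, for which there are a set $X$ (the base) and an equivalence relation $E$ on $X$ such that every tuple $(x_1,\dots,x_{n+1})$ in every element lies in $X^{n+1}$ and has pairwise $E$-equivalent entries, and whose operations are $\boldsymbol f; g=\{(\boldsymbol x,z)\in X^{n+1} : \exists \boldsymbol y\in X^n,\ (\boldsymbol x,y_i)\in f_i \text{ for each } i \text{ and } (\boldsymbol y,z)\in g\}$, $\mathsf A_i(f)=\{(\boldsymbol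 x,x_i)\in X^{n+1} : x_1,\dots,x_n \text{ all } E\text{-equivalent and there is no } y\in X \text{ with } (\boldsymbol x,y)\in f\}$, $\mathsf F_i(f)=\{(\boldsymbol x,x_i)\in X^{n+1} : (\boldsymbol x,x_i)\in f\}$ (fixset), and preferential union: $(f\sqcup g)(\boldsymbol x)$ is $f(\boldsymbol x)$ if $f(\boldsymbol x)$ is defined, $g(\boldsymbol x)$ if $f(\boldsymbol x)$ is undefined but $g(\boldsymbol x)$ is defined, and undefined otherwise. An algebra is representable by injective $n$-ary partial functions if it is isomorphic to an algebra of $n$-ary partial functions of the same signature all of whose elements are injective. Notation: a bold symbol $\boldsymbol a$ in a term $\boldsymbol a; b$ stands for $\langle a_1,\dots,a_n\rangle$; unbracketed compositions associate to the right ($\boldsymbol a;\boldsymbol b; c=\boldsymbol a;(\boldsymbol b; c)$); for unary operations $\mathsf B_1,\dots,\mathsf B_n$, $\langle \mathsf B_1^n a\rangle$ means $\langle \mathsf B_1 a,\dots,\mathsf B_n a\rangle$. Abbreviations: $0:=\langle \mathsf A_1^n b\rangle; b$ for any $b$; $\pi_i:=\mathsf A_i 0$; $\boldsymbol\pi:=\langle\pi_1,\dots,\pi_n\rangle$; $\mathsf D_i a:=\mathsf A_i\mathsf A_i a$. *)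

(* Defs.v *)
From mathcomp Require Import all_boot.
From mathcomp Require Import classical_sets.
From Corelib Require Classes.RelationClasses.
From Stdlib Require List.

Set Implicit Arguments.
Unset Strict Implicit.
Unset Printing Implicit Defensive.

Local Open Scope classical_set_scope.

(* The indices 1, ..., n are the elements of 'I_n, and X^n is 'I_n -> X. *)

Record algebra (n : nat) := Algebra {
  carrier :> Type;
  comp : ('I_n -> carrier) -> carrier -> carrier;
  anti : 'I_n -> carrier -> carrier;
  fixset : 'I_n -> carrier -> carrier;
  pref : carrier -> carrier -> carrier;
  carrier_inhabited : inhabited carrier
}.

Arguments comp {n a}.
Arguments anti {n a}.
Arguments fixset {n a}.
Arguments pref {n a}.

Record isomorphism (n : nat) (A B : algebra n) (h : A -> B) : Prop := {
  iso_bij : bijective h;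
  iso_comp : forall (a : 'I_n -> A) b, h (comp a b) = comp (h \o a) (h b);
  iso_anti : forall i a, h (anti i a) = anti i (h a);
  iso_fixset : forall i a, h (fixset i a) = fixset i (h a);
  iso_pref : forall a b, h (pref a b) = pref (h a) (h b)
}.

Definition isomorphic (n : nat) (A B : algebra n) : Prop :=
  exists h : A -> B, isomorphism h.

Section PartialFunctions.

Variables (n : nat) (X : Type) (E : X -> X -> Prop).

(* A pair (x, z) stands for the (n+1)-tuple (x_1, ..., x_n, z). *)
Definition nrel := set (('I_n -> X) * X).

Definition partial_function (f : nrel) : Prop :=
  forall x y z, f (x, y) -> f (x, z) -> y = z.

Definition injective_pfun (f : nrel) : Prop :=
  forall x y z, f (x, z) -> f (y, z) -> x = y.

Definition args_equiv (x : 'I_n -> X) : Prop := forall i j, E (x i) (x j).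

Definition entries_equiv (f : nrel) : Prop :=
  forall x z, f (x, z) -> args_equiv x /\ forall i, E (x i) z.

Definition pcomp (f : 'I_n -> nrel) (g : nrel) : nrel :=
  [set p | exists y : 'I_n -> X, (forall i, f i (p.1, y i)) /\ g (y, p.2)].

Definition panti (i : 'I_n) (f : nrel) : nrel :=
  [set p | [/\ p.2 = p.1 i, args_equiv p.1 & ~ exists y, f (p.1, y)]].

Definition pfixset (i : 'I_n) (f : nrel) : nrel :=
  [set p | p.2 = p.1 i /\ f p].

Definition ppref (f g : nrel) : nrel :=
  [set p | f p \/ (~ (exists y, f (p.1, y)) /\ g p)].

Record pfun_universe (F : set nrel) : Prop := {
  univ_nonempty : F !=set0;
  univ_pfun : forall f, F f -> partial_function f;
  univ_equiv : forall f, F f -> entries_equiv f;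
  univ_comp : forall f g, (forall i, F (f i)) -> F g -> F (pcomp f g);
  univ_anti : forall i f, F f -> F (panti i f);
  univ_fixset : forall i f, F f -> F (pfixset i f);
  univ_pref : forall f g, F f -> F g -> F (ppref f g)
}.

Definition pfun_algebra (F : set nrel) (FU : pfun_universe F) : algebra n :=
  {| carrier := {f : nrel | F f};
     comp := fun f g => exist F (pcomp (fun i => sval (f i)) (sval g))
       (univ_comp FU (fun i => svalP (f i)) (svalP g));
     anti := fun i f => exist F (panti i (sval f)) (univ_anti FU i (svalP f));
     fixset := fun i f =>
       exist F (pfixset i (sval f)) (univ_fixset FU i (svalP f));
     pref := fun f g => exist F (ppref (sval f) (sval g))
       (univ_pref FU (svalP f) (svalP g));
     carrier_inhabited :=
       let: ex_intro f Ff := univ_nonempty FU in inhabits (exist F f Ff) |}.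

End PartialFunctions.

Definition injectively_representable (n : nat) (A : algebra n) : Prop :=
  exists (X : Type) (E : X -> X -> Prop) (F : set (nrel n X))
         (FU : pfun_universe E F),
    [/\ RelationClasses.Equivalence E,
        forall f, F f -> injective_pfun f
      & isomorphic A (pfun_algebra FU)].

(* The countably many variables are letters with a subscript, so that the
   entries of a bold symbol are variables with the same letter. *)
Inductive letter := La | Lb | Lc | Ld.

Definition var : Type := letter * nat.

Inductive term (n : nat) : Type :=
| TVar of var
| TComp of ('I_n -> term n) & term n
| TAnti of 'I_n & term n
| TFix of 'I_n & term n
| TPref of term n & term n.

Arguments TVar {n}.

Fixpoint eval (n : nat) (A : algebra n) (v : var -> A) (t : term n) : A :=
  match t with
  | TVar x => v x
  | TComp s t => comp (fun i => eval v (s i)) (eval v t)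
  | TAnti i t => anti i (eval v t)
  | TFix i t => fixset i (eval v t)
  | TPref s t => pref (eval v s) (eval v t)
  end.

Record equation (n : nat) := Equation { lhs : term n; rhs : term n }.

Record quasiequation (n : nat) := Quasiequation {
  premises : seq (equation n);
  conclusion : equation n
}.

Definition holds (n : nat) (A : algebra n) (v : var -> A) (e : equation n) :=
  eval v (lhs e) = eval v (rhs e).

Definition satisfies (n : nat) (A : algebra n) (q : quasiequation n) : Prop :=
  forall v : var -> A,
    (forall e, List.In e (premises q) -> holds v e) -> holds v (conclusion q).

Definition axiomatised_by (n : nat) (K : algebra n -> Prop)
    (Q : set (quasiequation n)) : Prop :=
  forall A : algebra n, K A <-> (forall q, Q q -> satisfies A q).

Definition quasivariety (n : nat) (K : algebra n -> Prop) : Prop :=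
  exists Q : set (quasiequation n), axiomatised_by K Q.

Definition finitely_axiomatised_by (n : nat) (K : algebra n -> Prop)
    (Q : seq (quasiequation n)) : Prop :=
  axiomatised_by K [set q | List.In q Q].

Declare Scope term_scope.
Delimit Scope term_scope with term.
Bind Scope term_scope with term.
Notation "s ;; t" := (TComp s t)
  (at level 45, right associativity) : term_scope.
Notation "s ⊔ t" := (TPref s t) (at level 40, no associativity) : term_scope.
Notation "s ≈ t" := (Equation s%term t%term) (at level 70, no associativity).
Notation "⊢ e" := (Quasiequation [::] e) (at level 75).
Notation "p ⊢ e" := (Quasiequation p e) (at level 75, no associativity).

Section Axiomatisation.

Variable n : nat.

Implicit Types (i j k : 'I_n) (t : term n).

Local Open Scope term_scope.

Definition tD i t : term n := TAnti i (TAnti i t).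
Definition vecA t : 'I_n -> term n := fun i => TAnti i t.
Definition vecD t : 'I_n -> term n := fun i => tD i t.

Let a : term n := TVar (La, 0).
Let b : term n := TVar (Lb, 0).
Let c : term n := TVar (Lc, 0).
Let a_ i : term n := TVar (La, nat_of_ord i).
Let b_ i : term n := TVar (Lb, nat_of_ord i).
Let c_ i : term n := TVar (Lc, nat_of_ord i).

(* 0 is an abbreviation relative to an arbitrary element. The letter d is kept
   for that element: it occurs in the axioms only through tzero, and ax3
   makes the choice of its value irrelevant. *)
Definition tzero : term n := vecA (TVar (Ld, 0)) ;; TVar (Ld, 0).
Definition tpi i : term n := TAnti i tzero.

Definition ax1 := ⊢ (fun i => a_ ;; b_ i) ;; c ≈ a_ ;; b_ ;; c.
Definition ax2 := ⊢ tpi ;; a ≈ a.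
Definition ax3 := ⊢ vecA a ;; a ≈ vecA b ;; b.
Definition ax4 i := ⊢ (fun j => if j == i then tzero else a_ j) ;; b ≈ tzero.
Definition ax5 := ⊢ a_ ;; tzero ≈ tzero.
Definition ax6 i :=
  ⊢ a_ ;; TAnti i b
    ≈ vecA (a_ ;; b) ;; foldr (fun j t => vecD (a_ j) ;; t) (a_ i) (enum 'I_n).
Definition ax7 :=
  [:: vecD a ;; b ≈ vecD a ;; c; vecA a ;; b ≈ vecA a ;; c] ⊢ b ≈ c.
Definition ax8 := ⊢ vecD a ;; a ≈ a.
Definition ax9 i j k :=
  ⊢ TAnti i (TAnti j a) ≈ TAnti i (TAnti k a).
Definition ax10 i := [:: b_ ;; a ≈ c_ ;; a] ⊢ b_ ;; tD i a ≈ c_ ;; tD i a.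
Definition ax11 := ⊢ vecD a ;; (a ⊔ b) ≈ a.
Definition ax12 := ⊢ vecA a ;; (a ⊔ b) ≈ vecA a ;; b.
Definition ax13 i := ⊢ tD i (TFix i a) ≈ TFix i a.
Definition ax14 i := ⊢ vecD (TFix i a) ;; a ≈ TFix i a.
Definition ax15 i := [:: b_ ;; a ≈ b_ i] ⊢ b_ ;; TFix i a ≈ b_ i.

Definition axioms : seq (quasiequation n) :=
  [:: ax1; ax2; ax3]
  ++ [seq ax4 i | i <- enum 'I_n]
  ++ [:: ax5]
  ++ [seq ax6 i | i <- enum 'I_n]
  ++ [:: ax7; ax8]
  ++ [seq ax9 p.1 p.2 k | p <- [seq (i, j) | i <- enum 'I_n, j <- enum 'I_n],
                          k <- enum 'I_n]
  ++ [seq ax10 i | i <- enum 'I_n]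
  ++ [:: ax11; ax12]
  ++ [seq ax13 i | i <- enum 'I_n]
  ++ [seq ax14 i | i <- enum 'I_n]
  ++ [seq ax15 i | i <- enum 'I_n].

End Axiomatisation.

(* Main.v *)
From mathcomp Require Import all_boot.
From mathcomp Require Import boolp classical_sets.
From Corelib Require Classes.RelationClasses.
From Stdlib Require List.
Require Import Defs.

Set Implicit Arguments.
Unset Strict Implicit.
Unset Printing Implicit Defensive.

Local Open Scope classical_set_scope.

(** Why the theorem is true.

    Soundness is a computation with partial functions on E-equivalent tuples;
    injectivity is used for the quasiequation that turns b; a = c; a into
    b; D_i a = c; D_i a. Quasiequations pass along isomorphisms.

    For completeness, let A satisfy the axioms. Write a ◁ b for <D a>; b and
    a ⩤ b for <A a>; b: these stand for b restricted to, respectively away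
    from, the domain of a. The axioms make the operators a ⩤ _ a Boolean
    algebra: they commute, a ⩤ _ and a ◁ _ are complementary (law_split), and
    they are closed under composition (joinE). A set U of elements is an ideal
    of this Boolean algebra if it contains 0 and if a ∈ U, a ⩤ b ∈ U imply
    b ∈ U; when it is prime, it behaves as a point of a space on which the
    elements of A are partially defined, and a ∈ U says that a is undefined
    at U.

    Two elements have the same germ at U if some c ∈ U satisfies
    c ⩤ a = c ⩤ b (eqv). The base of the representation consists of the
    nonzero germs at all prime ideals, two of them being E-equivalent when they
    live at the same prime ideal, and an element a acts by right composition:
    it sends the germs of x_1, ..., x_n to the germ of <x_1, ..., x_n>; a
    whenever that is nonzero (rep). The axioms on composition with antidomains
    say what right composition with A_i a does at a prime ideal
    (eqv_comp_anti), and from this every operation is seen to be preserved.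
    Cancelling a on germs, by the quasiequation above, makes rep a injective as
    a partial function. Finally, if a and b differ, then the c with
    c ◁ a = c ◁ b form a proper ideal, and at any prime ideal above it a and b
    have different germs (separation); acting on the germs of the projections,
    which satisfy π; a = a, the elements a and b then give different
    functions. *)

(** * The axioms as laws of an algebra *)

Definition dom_restr (n : nat) (A : algebra n) (a b : A) : A :=
  comp (fun i => anti i (anti i a)) b.
Definition dom_antirestr (n : nat) (A : algebra n) (a b : A) : A :=
  comp (fun i => anti i a) b.

Local Notation "a ◁ b" := (dom_restr a b)
  (at level 45, right associativity).
Local Notation "a ⩤ b" := (dom_antirestr a b)
  (at level 45, right associativity).

(** The axioms read in A, with o for the constant 0. The nested composition
    <D a_1>; ...; <D a_n>; a_i appears as a fold over the indices. *)
Record laws (n : nat) (A : algebra n) (o : A) : Prop := {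
  law_assoc : forall (a b : 'I_n -> A) c,
    comp (fun i => comp a (b i)) c = comp a (comp b c);
  law_out0 : forall a : A, o ⩤ a = a;
  law_outxx : forall a : A, a ⩤ a = o;
  law_0comp : forall (a : 'I_n -> A) i b, a i = o -> comp a b = o;
  law_comp0 : forall a : 'I_n -> A, comp a o = o;
  law_comp_anti : forall (a : 'I_n -> A) i b,
    comp a (anti i b)
    = comp a b ⩤ foldr (fun j t => a j ◁ t) (a i) (enum 'I_n);
  law_split : forall a b c : A, a ◁ b = a ◁ c -> a ⩤ b = a ⩤ c -> b = c;
  law_onxx : forall a : A, a ◁ a = a;
  law_anti2 : forall i j k (a : A), anti i (anti j a) = anti i (anti k a);
  law_inj : forall i (a : A) b c, comp b a = comp c a ->
    comp b (anti i (anti i a)) = comp c (anti i (anti i a));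
  law_pref_on : forall a b : A, a ◁ pref a b = a;
  law_pref_out : forall a b : A, a ⩤ pref a b = a ⩤ b;
  law_fix_dom : forall i (a : A), anti i (anti i (fixset i a)) = fixset i a;
  law_fix_on : forall i (a : A), fixset i a ◁ a = fixset i a;
  law_fix_val : forall i (a : A) b, comp b a = b i -> comp b (fixset i a) = b i
}.

Lemma forall_in_cons (T : Type) (P : T -> Prop) x s :
  (forall q, List.In q (x :: s) -> P q) <-> P x /\ forall q, List.In q s -> P q.
Proof.
split=> [H|[Px H] q [<-|]//]; last exact: H.
by split=> [|q qs]; apply: H; [left | right].
Qed.

Lemma forall_in_cat (T : Type) (P : T -> Prop) s t :
  (forall q, List.In q (s ++ t) -> P q) <->
  (forall q, List.In q s -> P q) /\ forall q, List.In q t -> P q.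
Proof.
elim: s => [|x s IH]; first by split=> [H|[_ H]] //.
by rewrite cat_cons !forall_in_cons IH and_assoc.
Qed.

Lemma forall_in_map (T : eqType) (S : Type) (f : T -> S) (P : S -> Prop) s :
  (forall q, List.In q (map f s) -> P q) <-> forall x, x \in s -> P (f x).
Proof.
elim: s => [|x s IH]; first by split.
rewrite forall_in_cons IH; split=> [[Px H] y|H].
  by rewrite inE => /predU1P[->|/H].
by split=> [|y ys]; apply: H; rewrite inE ?eqxx ?ys ?orbT.
Qed.

Lemma forall_in_allpairs (T1 T2 : eqType) (S : Type) (f : T1 -> T2 -> S)
    (P : S -> Prop) s t :
  (forall q, List.In q [seq f x y | x <- s, y <- t] -> P q) <->
  forall x y, x \in s -> y \in t -> P (f x y).
Proof.
elim: s => [|x s IH]; first by split.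
rewrite allpairs_cons forall_in_cat IH forall_in_map; split=> [[Px H] y z|H].
  by rewrite inE => /predU1P[->|/H]; auto.
by split=> [y|y z ys]; apply: H; rewrite inE ?eqxx ?ys ?orbT.
Qed.

Lemma axiomsP (n : nat) (P : quasiequation n -> Prop) :
  (forall q, List.In q (axioms n) -> P q) <->
  P (ax1 n) /\ P (ax2 n) /\ P (ax3 n) /\ (forall i, P (ax4 i)) /\ P (ax5 n) /\
  (forall i, P (ax6 i)) /\ P (ax7 n) /\ P (ax8 n) /\
  (forall i j k, P (ax9 i j k)) /\ (forall i, P (ax10 i)) /\
  P (ax11 n) /\ P (ax12 n) /\ (forall i, P (ax13 i)) /\
  (forall i, P (ax14 i)) /\ (forall i, P (ax15 i)).
Proof.
have enumP (f : 'I_n -> quasiequation n) :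
    (forall q, List.In q [seq f i | i <- enum 'I_n] -> P q) <->
    forall i, P (f i).
  by rewrite forall_in_map; split=> H i; [apply: H; rewrite mem_enum | auto].
have pairP : (forall q, List.In q [seq ax9 p.1 p.2 k |
        p <- [seq (i, j) | i <- enum 'I_n, j <- enum 'I_n],
        k <- enum 'I_n] -> P q) <->
    forall i j k, P (ax9 i j k).
  rewrite forall_in_allpairs; split=> [H i j k|H p k _ _]; last exact: H.
  by apply: (H (i, j)); rewrite ?mem_enum // allpairs_f // mem_enum.
rewrite /axioms !forall_in_cat !enumP pairP !forall_in_cons.
have nilP : (forall q : quasiequation n, List.In q [::] -> P q) <-> True.
  by split.
by rewrite nilP; tauto.
Qed.

Section Satisfaction.

Variables (n : nat) (A : algebra n).

Lemma satisfies0 e : satisfies A (⊢ e) <-> forall v : var -> A, holds v e.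
Proof. by split=> [H v|H v _]; apply: H. Qed.

Lemma satisfies1 e0 e : satisfies A ([:: e0] ⊢ e) <->
  forall v : var -> A, holds v e0 -> holds v e.
Proof.
split=> H v hv; apply: H; last by apply: hv; left.
by move=> q [<-|].
Qed.

Lemma satisfies2 e0 e1 e : satisfies A ([:: e0; e1] ⊢ e) <->
  forall v : var -> A, holds v e0 -> holds v e1 -> holds v e.
Proof.
split=> [H v hv0 hv1|H v hv]; apply: H.
- by move=> q [<-|[<-|]].
- by apply: hv; left.
- by apply: hv; right; left.
Qed.

(** Each law is the matching axiom at a suitable valuation; the work is only
    to realise a family indexed by 1, ..., n as the values of the variables
    carrying one letter. *)
Lemma laws_of_axioms :
  (forall q, List.In q (axioms n) -> satisfies A q) -> exists o : A, laws o.
Proof.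
have [w] := carrier_inhabited A.
pose val (a b c : nat -> A) (x : var) : A :=
  match x.1 with La => a x.2 | Lb => b x.2 | Lc => c x.2 | Ld => w end.
pose cst (a : A) (k : nat) := a.
have extP (f : 'I_n -> A) : exists g : nat -> A, f = fun i => g i.
  exists (fun k => oapp f w (insub k)); apply: funext => i.
  by rewrite valK.
pose o := w ⩤ w.
case/axiomsP => /satisfies0 H1 [/satisfies0 H2] [/satisfies0 H3].
case=> H4 [/satisfies0 H5] [H6] [/satisfies2 H7] [/satisfies0 H8] [H9] [H10].
case=> [/satisfies0 H11] [/satisfies0 H12] [H13] [H14] H15.
exists o; split.
- move=> a b c; have [[a' ->] [b' ->]] := (extP a, extP b).
  exact: (H1 (val a' b' (cst c))).
- by move=> a; apply: (H2 (val (cst a) (cst w) (cst w))).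
- by move=> a; apply: (H3 (val (cst a) (cst w) (cst w))).
- move=> a i b; have [a' ->] := extP a => ai.
  apply: etrans (proj1 (satisfies0 _) (H4 i) (val a' (cst b) (cst w))).
  congr comp; apply: funext => j /=.
  by case: eqP => [->|//]; rewrite ai.
- move=> a; have [a' ->] := extP a.
  exact: (H5 (val a' (cst w) (cst w))).
- move=> a i b; have [a' ->] := extP a.
  have := proj1 (satisfies0 _) (H6 i) (val a' (cst b) (cst w)).
  rewrite /holds /= => ->; congr comp.
  by elim: (enum 'I_n) => //= j s ->.
- by move=> a b c; apply: (H7 (val (cst a) (cst b) (cst c))).
- by move=> a; apply: (H8 (val (cst a) (cst w) (cst w))).
- move=> i j k a.
  exact: (proj1 (satisfies0 _) (H9 i j k) (val (cst a) (cst w) (cst w))).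
- move=> i a b c; have [[b' ->] [c' ->]] := (extP b, extP c).
  exact: (proj1 (satisfies1 _ _) (H10 i) (val (cst a) b' c')).
- by move=> a b; apply: (H11 (val (cst a) (cst b) (cst w))).
- by move=> a b; apply: (H12 (val (cst a) (cst b) (cst w))).
- move=> i a.
  exact: (proj1 (satisfies0 _) (H13 i) (val (cst a) (cst w) (cst w))).
- move=> i a.
  exact: (proj1 (satisfies0 _) (H14 i) (val (cst a) (cst w) (cst w))).
- move=> i a b; have [b' ->] := extP b.
  exact: (proj1 (satisfies1 _ _) (H15 i) (val (cst a) b' (cst w))).
Qed.

Lemma axioms_of_laws (o : A) : laws o ->
  forall q, List.In q (axioms n) -> satisfies A q.
Proof.
move=> L; pose v0 (v : var -> A) : eval v (tzero n) = o := law_outxx L _.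
have piE v : (fun i => eval v (tpi i)) = (fun i : 'I_n => anti i o).
  by apply: funext => i; rewrite /= -[in RHS](v0 v).
apply/axiomsP.
do !split.
- by apply/satisfies0 => v; apply: (law_assoc L).
- by apply/satisfies0 => v; rewrite /holds [LHS]/= piE; apply: (law_out0 L).
- by apply/satisfies0 => v; apply: etrans (esym _); apply: (law_outxx L).
- move=> i; apply/satisfies0 => v; apply: etrans (esym (v0 v)).
  by apply: (law_0comp L (i := i)); rewrite eqxx; apply: v0.
- apply/satisfies0 => v; apply: etrans (esym (v0 v)).
  by rewrite /= [X in comp _ X]v0; apply: (law_comp0 L).
- move=> i; apply/satisfies0 => v; rewrite /holds /= [LHS](law_comp_anti L).
  by congr comp; elim: (enum 'I_n) => //= j s ->.
- by apply/satisfies2 => v; apply: (law_split L).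
- by apply/satisfies0 => v; apply: (law_onxx L).
- by move=> i j k; apply/satisfies0 => v; apply: (law_anti2 L).
- by move=> i; apply/satisfies1 => v; apply: (law_inj L).
- by apply/satisfies0 => v; apply: (law_pref_on L).
- by apply/satisfies0 => v; apply: (law_pref_out L).
- by move=> i; apply/satisfies0 => v; apply: (law_fix_dom L).
- by move=> i; apply/satisfies0 => v; apply: (law_fix_on L).
- by move=> i; apply/satisfies1 => v; apply: (law_fix_val L).
Qed.

End Satisfaction.

(** Satisfaction is needed on the abstract side of a representation, while the
    laws are checked on the concrete one. *)
Lemma satisfies_isomorphic (n : nat) (A B : algebra n) q :
  isomorphic A B -> satisfies B q -> satisfies A q.
Proof.
move=> [h [/bij_inj h_inj hcomp hanti hfix hpref]] Bq v prem.
have evalE t : eval (h \o v) t = h (eval v t).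
  elim: t => /= [//|s IHs t ->|i t ->|i t ->|s -> t ->] //.
  by rewrite hcomp; congr comp; apply: funext => i; apply: IHs.
apply: h_inj; rewrite -!evalE; apply: Bq => e /prem; rewrite /holds !evalE.
by move=> ->.
Qed.

(** * Algebras of injective partial functions satisfy the laws *)

Section Soundness.

Variables (n : nat) (i0 : 'I_n) (X : Type) (E : X -> X -> Prop).
Variables (F : set (nrel n X)) (FU : pfun_universe E F).
Hypothesis E_equiv : RelationClasses.Equivalence E.
Hypothesis F_inj : forall f, F f -> injective_pfun f.

Local Notation B := (pfun_algebra FU).
Implicit Types (f g : B) (x : 'I_n -> X).

Definition defined f x := exists z, sval f (x, z).

Lemma pfun_ext f g :
  (forall x z, sval f (x, z) <-> sval g (x, z)) -> f = g.
Proof.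
case: f g => [f fP] [g gP] /= fg.
have e : f = g by apply/predeqP => -[x z]; apply: fg.
by subst g; congr exist; apply: Prop_irrelevance.
Qed.

Lemma pfun_fun f x y z : sval f (x, y) -> sval f (x, z) -> y = z.
Proof. exact: (univ_pfun FU (svalP f)). Qed.

Lemma defined_equiv f x : defined f x -> args_equiv E x.
Proof. by case=> z xz; case: (univ_equiv FU (svalP f) xz). Qed.

(** The values of a tuple of functions at one point are all equivalent to its
    first argument, so they form a tuple at which antidomains can be defined.
    This is where a positive arity and transitivity of E are needed. *)
Lemma value_equiv (f : 'I_n -> B) x y :
  (forall i, sval (f i) (x, y i)) -> args_equiv E y.
Proof.
move=> xy i j.
have yE k := proj2 (univ_equiv FU (svalP (f k)) (xy k)) i0.
case: E_equiv => _ Esym Etrans.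
exact: Etrans (Esym _ _ (yE i)) (yE j).
Qed.

Lemma antiP i f x z :
  sval (anti i f) (x, z) <-> [/\ z = x i, args_equiv E x & ~ defined f x].
Proof. by []. Qed.

Lemma defined_anti i f x :
  defined (anti i f) x <-> args_equiv E x /\ ~ defined f x.
Proof. by split=> [[z []]|[]]; last exists (x i). Qed.

Lemma domP i j f x z :
  sval (anti i (anti j f)) (x, z) <-> z = x i /\ defined f x.
Proof.
rewrite antiP; split=> [[-> xE nf]|[-> fx]].
  by split=> //; apply: contrapT => nfx; apply/nf/defined_anti.
by split=> //; [exact: defined_equiv fx | move=> /defined_anti[]].
Qed.

Lemma outP f g x z : sval (f ⩤ g) (x, z) <-> ~ defined f x /\ sval g (x, z).
Proof.
split=> [[y [/= fy gy]]|[nf gx]].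
  have xy : y = x by apply: funext => i; case/antiP: (fy i).
  by subst y; split=> //; case/antiP: (fy i0).
exists x; split=> // i; apply/antiP; split=> //.
by apply: (@defined_equiv g); exists z.
Qed.

Lemma onP f g x z : sval (f ◁ g) (x, z) <-> defined f x /\ sval g (x, z).
Proof.
split=> [[y [/= fy gy]]|[fx gx]]; last by exists x; split=> // i; apply/domP.
have xy : y = x by apply: funext => i; case/domP: (fy i).
by subst y; split=> //; case/domP: (fy i0).
Qed.

Lemma foldr_onP (a : 'I_n -> B) f s x z :
  sval (foldr (fun j t => a j ◁ t) f s) (x, z) <->
  (forall j, j \in s -> defined (a j) x) /\ sval f (x, z).
Proof.
elim: s => [|j s IH]; first by split=> [|[]].
apply: iff_trans (onP _ _ _ _) _; rewrite IH; split=> [[jx [sx fx]]|[sx fx]].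
  by split=> // k; rewrite inE => /predU1P[->|/sx].
by do !split=> //; [|move=> k ks]; apply: sx; rewrite inE ?eqxx ?ks ?orbT.
Qed.

Lemma concrete_laws : exists o : B, laws o.
Proof.
have [w] := carrier_inhabited B; exists (w ⩤ w).
have o0 x z : ~ sval (w ⩤ w) (x, z).
  by move=> /outP[nw wx]; apply: nw; exists z.
have compP (a : 'I_n -> B) f x z : sval (comp a f) (x, z) <->
  exists2 y, forall i, sval (a i) (x, y i) & sval f (y, z).
  by split=> [[y []]|[y]]; exists y.
have no x : ~ defined (w ⩤ w) x by case=> z /o0.
split.
- move=> a b c; apply: pfun_ext => x z; rewrite !compP; split.
    move=> [y xy yz].
    have /choice[t tP] i :
        exists t, (forall j, sval (a j) (x, t j)) /\ sval (b i) (t, y i).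
      by case/compP: (xy i) => t; exists t.
    exists (t i0); first by case: (tP i0).
    apply/compP; exists y => // i; case: (tP i) => ti.
    suff -> : t i = t i0 by [].
    apply: funext => j; apply: pfun_fun (ti j) _.
    by case: (tP i0).
  move=> [y xy /compP[t yt tz]]; exists t => // i.
  by apply/compP; exists y.
- by move=> a; apply: pfun_ext => x z; rewrite outP; split=> [[]|] //; split.
- move=> a; apply: pfun_ext => x z; split=> [/outP[na az]|/o0//].
  by case: na; exists z.
- move=> a i b ai; apply: pfun_ext => x z; split=> [/compP[y xy _]|/o0//].
  by have := xy i; rewrite ai => /o0.
- by move=> a; apply: pfun_ext => x z; split=> [/compP[y _ /o0]|/o0].
- move=> a i b; apply: pfun_ext => x z; rewrite compP outP foldr_onP; split.
    move=> [y xy /antiP[-> _ nb]]; split.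
      move=> [t /compP[y' xy' bt]]; apply: nb; exists t.
      rewrite (_ : y = y') //; apply: funext => j.
      exact: pfun_fun (xy j) (xy' j).
    by split=> // j _; exists (y j).
  move=> [nb [ax az]].
  have /choice[y xy] j : defined (a j) x by apply: ax; rewrite mem_enum.
  exists y => //; apply/antiP; split.
  - exact: pfun_fun az (xy i).
  - exact: value_equiv xy.
  - by move=> [t bt]; apply: nb; exists t; apply/compP; exists y.
- move=> a b c abc nabc; apply: pfun_ext => x z.
  have [ax|nax] := pselect (defined a x).
    have onE d : sval (a ◁ d) (x, z) <-> sval d (x, z).
      by rewrite onP; split=> [[]|].
    by rewrite -onE abc onE.
  have outE d : sval (a ⩤ d) (x, z) <-> sval d (x, z).
    by rewrite outP; split=> [[]|].
  by rewrite -outE nabc outE.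
- move=> a; apply: pfun_ext => x z; rewrite onP; split=> [[]//|ax]; split=> //.
  by exists z.
- by move=> i j k a; apply: pfun_ext => x z; rewrite !domP.
- move=> i a b c bc.
  suff sub b' c' : comp b' a = comp c' a -> forall x z,
      sval (comp b' (anti i (anti i a))) (x, z) ->
      sval (comp c' (anti i (anti i a))) (x, z).
    by apply: pfun_ext => x z; split; apply: sub.
  move=> e x _ /compP[y xy /domP[-> [t yt]]].
  have : sval (comp b' a) (x, t) by apply/compP; exists y.
  rewrite e => /compP[y' xy' y't]; apply/compP; exists y' => //.
  apply/domP; split; last by exists t.
  by rewrite (F_inj (svalP a) yt y't).
- move=> a b; apply: pfun_ext => x z; rewrite onP.
  split=> [[[t xt] [//|[]]]|ax]; first by case; exists t.
  by split; [exists z | left].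
- move=> a b; apply: pfun_ext => x z; rewrite !outP.
  split=> [[na [ax|[_ bx]]]|[na bx]]; split=> //; last by right.
  by case: na; exists z.
- move=> i a; apply: pfun_ext => x z; rewrite domP.
  split=> [[-> [t [/= e ideal_of]]]|[/= e ax]]; first by rewrite -e.
  by split=> //; exists z.
- move=> i a; apply: pfun_ext => x z; rewrite onP.
  split=> [[[t [/= e xt]] xz]|[/= e ax]]; last by split=> //; exists z.
  by rewrite (pfun_fun xz xt).
- move=> i a b bi; apply: pfun_ext => x z; rewrite compP; split.
    by move=> [y xy [/= -> _]].
  move=> xz; have := xz; rewrite -{1}bi => /compP[y xy yz]; exists y => //.
  by split=> //=; apply: pfun_fun xz (xy i).
Qed.

End Soundness.

(** * The Boolean algebra of domain restrictions *)

Section Representation.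

Variables (n : nat) (A : algebra n) (o : A) (L : laws o) (i0 : 'I_n).
Implicit Types (a b c : A) (i j k : 'I_n).

(** An iterated antidomain A_i A_k a does not depend on k, so restricting to a
    domain is restricting away from the domain of an antidomain; facts on ⩤
    then carry over to ◁. *)
Lemma onE k a x : a ◁ x = anti k a ⩤ x.
Proof.
by congr comp; apply: funext => i; apply: (law_anti2 L).
Qed.

Lemma comp_out (f : 'I_n -> A) a x :
  comp f (a ⩤ x) = comp (fun i => comp f (anti i a)) x.
Proof. by rewrite (law_assoc L). Qed.

Lemma out_comp (f : 'I_n -> A) a x :
  a ⩤ comp f x = comp (fun i => a ⩤ f i) x.
Proof. by rewrite [RHS](law_assoc L). Qed.

Lemma comp_on (f : 'I_n -> A) a x :
  comp f (a ◁ x) = comp (fun i => comp f (anti i (anti i a))) x.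
Proof. by rewrite (law_assoc L). Qed.

Lemma out_0 a : a ⩤ o = o. Proof. exact: (law_comp0 L). Qed.

Lemma onxanti a i : a ◁ anti i a = o.
Proof. by rewrite (onE i) (law_outxx L). Qed.

Lemma on_out a x : a ◁ a ⩤ x = o.
Proof.
by rewrite [LHS]comp_out; apply: (law_0comp L (i := i0)); apply: onxanti.
Qed.

(** This makes the trailing factors <D a_1>; ...; <D a_n> of the law for
    a; A_i b disappear when the entries of a are antidomains of one element;
    out_anti is the resulting exchange law. *)
Lemma anti_on_anti a i j : anti j a ◁ anti i a = anti i a.
Proof.
rewrite -[RHS](law_onxx L); congr comp; apply: funext => k.
by congr anti; apply: (law_anti2 L).
Qed.

Lemma out_anti a b i : a ⩤ anti i b = (a ⩤ b) ⩤ anti i a.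
Proof.
rewrite /dom_antirestr (law_comp_anti L); congr comp.
by elim: (enum 'I_n) => //= j s ->; apply: anti_on_anti.
Qed.

Lemma out_antixx a i : a ⩤ anti i a = anti i a.
Proof. by rewrite out_anti (law_outxx L) (law_out0 L). Qed.

Lemma outK a x : a ⩤ a ⩤ x = a ⩤ x.
Proof.
by rewrite [LHS]comp_out; congr comp; apply: funext => i; apply: out_antixx.
Qed.

Lemma onK a x : a ◁ a ◁ x = a ◁ x.
Proof. by rewrite !(onE i0) outK. Qed.

Lemma out_dom a i j : a ⩤ anti i (anti j a) = o.
Proof. by rewrite (law_anti2 L i j i) out_anti out_antixx (law_outxx L). Qed.

(** Both sides vanish on the domain of a and agree with A_i a off it. *)
Lemma anti3 a i j k : anti i (anti j (anti k a)) = anti i a.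
Proof.
rewrite (law_anti2 L i j i) (law_anti2 L i k i).
apply: (law_split L (a := a)).
  by rewrite onxanti (onE i) out_anti out_antixx (law_outxx L).
by rewrite out_anti out_dom (law_out0 L) out_antixx.
Qed.

Lemma outE k a x : a ⩤ x = anti k a ◁ x.
Proof. by congr comp; apply: funext => i; rewrite anti3. Qed.

Lemma out_on a x : a ⩤ a ◁ x = o.
Proof. by rewrite (onE i0) (outE i0) on_out. Qed.

(** The tool for the commutation of restrictions: by out_anti, deciding b after
    a restriction is the same as deciding the restriction of b. *)
Lemma out_out a b x : a ⩤ b ⩤ x = (a ⩤ b) ⩤ a ⩤ x.
Proof.
rewrite [LHS]comp_out [RHS]comp_out; congr comp; apply: funext => i.
exact: out_anti.
Qed.

Lemma out_onE a b x : a ◁ b ⩤ x = (a ◁ b) ⩤ a ◁ x.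
Proof. by rewrite !(onE i0) out_out. Qed.

(** On the domain of a, the left side is zero, and so is the right one because
    out_onE moves A b past D a, where D a meets A_i a; off the domain of a, both
    sides are a ⩤ A_i b. *)
Lemma outC a b x : a ⩤ b ⩤ x = b ⩤ a ⩤ x.
Proof.
suff H i : a ⩤ anti i b = b ⩤ anti i a.
  rewrite [LHS]comp_out [RHS]comp_out; congr comp; apply: funext => i.
  exact: H.
apply: (law_split L (a := a)); first by rewrite on_out out_onE onxanti out_0.
by rewrite outK [RHS]out_out out_antixx -out_anti.
Qed.

Lemma out_onC a b x : a ⩤ b ◁ x = b ◁ a ⩤ x.
Proof. by rewrite !(onE i0) outC. Qed.

Lemma on_id a x : a ⩤ x = o -> a ◁ x = x.
Proof. by move=> ax; apply: (law_split L (a := a)); rewrite ?onK // out_on. Qed.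

Lemma out_id a x : a ◁ x = o -> a ⩤ x = x.
Proof. by move=> ax; rewrite (outE i0) on_id // -(onE i0). Qed.

(** The domain of b is no larger than b itself: if b vanishes off a, so does
    anything restricted to the domain of b. *)
Lemma out_on0 a b x : a ⩤ b = o -> a ⩤ b ◁ x = o.
Proof.
move=> ab; rewrite (onE i0) [LHS]comp_out.
apply: (law_0comp L (i := i0)); rewrite [LHS]out_anti.
suff -> : a ⩤ anti i0 b = anti i0 a by rewrite (law_outxx L).
by rewrite out_anti ab (law_out0 L).
Qed.

Lemma on_on0 a b x : a ◁ b = o -> a ◁ b ◁ x = o.
Proof. by rewrite !(onE i0 a); apply: out_on0. Qed.

(** The part of the domain of b lying off a is the domain of a ⩤ b. *)
Lemma out_onA a b x : a ⩤ b ◁ x = (a ⩤ b) ◁ x.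
Proof.
set z := a ⩤ b.
have zab : z ⩤ a ⩤ b ◁ x = o by rewrite -out_out out_on out_0.
apply: (law_split L (a := z)); last by rewrite zab out_on.
have az : a ◁ z = o by rewrite on_out.
have bz : b ⩤ z = o by rewrite outC (law_outxx L) out_0.
rewrite onK (onE i0) outC [anti _ _ ⩤ _]out_onC -(onE i0).
rewrite [_ ◁ _ ◁ _]on_id; last exact: out_on0.
by rewrite out_id // on_on0.
Qed.

(** Composition with an antidomain, for a tuple whose entries share their
    domain. *)
Lemma comp_anti (f : 'I_n -> A) i b : (forall j, f j ◁ f i = f i) ->
  comp f (anti i b) = comp f b ⩤ f i.
Proof.
move=> fi; rewrite (law_comp_anti L); congr dom_antirestr.
by elim: (enum 'I_n) => //= j s ->.
Qed.

(** Plays the part of the union of two domains: its antidomains are the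
    composites a ⩤ A_j b. *)
Definition join a b := anti i0 (a ⩤ anti i0 b).

(** The tuple s of the a ⩤ A_j b is a partial identity with common domain, the
    complement of the domains of a and b. What has to be seen is that
    D_j (s_i0) = s_j. As D_j (s_i0) lives on the domain of s it is fixed by
    composition with s, and that composition can be computed with comp_anti. *)
Lemma joinE a b x : join a b ⩤ x = a ⩤ b ⩤ x.
Proof.
pose s i := a ⩤ anti i b.
have sE y : comp s y = a ⩤ b ⩤ y by rewrite [RHS]comp_out.
have ss i j : s i ⩤ s j = o.
  by rewrite -out_out -(onE i) onxanti out_0.
suff sD j : anti j (join a b) = s j.
  by rewrite -sE; congr comp; apply: funext => j; apply: sD.
pose z := s i0; rewrite /join -/(s i0) -/z.
have zD : z ◁ anti j (anti i0 z) = anti j (anti i0 z).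
  by rewrite (onE i0) out_antixx.
have s_id y : z ◁ y = y -> comp s y = y.
  have az : a ◁ z = o by apply: on_out.
  have bz : b ◁ z = o by rewrite /z /s -out_onC onxanti out_0.
  by move=> zy; rewrite sE !out_id // -zy on_on0.
rewrite -(s_id _ zD) (law_anti2 L j i0 j).
have on_s i : s i ◁ s j = s j by apply: on_id.
by rewrite !comp_anti // (s_id z) ?(law_onxx L) // ss (law_out0 L).
Qed.

(** * Prime ideals and germs *)

(** Taking a ⩤ b = 0 in the closure condition shows that U is downward closed
    for inclusion of domains, and ideal_join that it is closed under unions: U
    is an ideal in the usual sense, of the Boolean algebra of domains, pulled
    back to the elements. *)
Definition ideal (U : set A) :=
  U o /\ forall a b, U a -> U (a ⩤ b) -> U b.

Record prime_ideal (U : set A) : Prop := {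
  prime_ideal_ideal : ideal U;
  prime_anti : forall a i, U a -> ~ U (anti i a);
  prime_max : forall a i, ~ U a -> U (anti i a)
}.

Lemma ideal_out0 U a b : ideal U -> U a -> a ⩤ b = o -> U b.
Proof. by case=> U0 Uout Ua ab; apply: Uout Ua _; rewrite ab. Qed.

Lemma ideal_join U a b : ideal U -> U a -> U b -> U (join a b).
Proof.
move=> Uid Ua Ub; apply: (proj2 Uid) (Ua) _.
by apply: ideal_out0 (Ub) _ => //; rewrite outC -joinE (law_outxx L).
Qed.

(** Equality of germs at U: agreement after deleting a domain that is negligible
    at U. *)
Definition eqv (U : set A) a b := exists2 c, U c & c ⩤ a = c ⩤ b.

Section Eqv.

Variables (U : set A) (Uid : ideal U).

Lemma eqv_refl a : eqv U a a.
Proof. by exists o => //; case: Uid. Qed.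

Lemma eqv_sym a b : eqv U a b -> eqv U b a.
Proof. by case=> c Uc e; exists c. Qed.

Lemma eqv_trans b a c : eqv U a b -> eqv U b c -> eqv U a c.
Proof.
move=> [d Ud ab] [e Ue bc]; exists (join d e); first exact: ideal_join.
by rewrite !joinE outC ab outC bc.
Qed.

Lemma eqv0P a : eqv U a o <-> U a.
Proof.
split=> [[c Uc]|Ua]; last by exists a; rewrite // (law_outxx L) out_0.
by rewrite out_0; apply: ideal_out0 Uc.
Qed.

Lemma eqv_ideal a b : eqv U a b -> U a -> U b.
Proof.
by move=> ab /eqv0P a0; apply/eqv0P; apply: eqv_trans a0; apply: eqv_sym.
Qed.

(** One negligible domain, a finite join, serves for all entries of the
    tuple. *)
Lemma eqv_comp (f g : 'I_n -> A) a :
  (forall i, eqv U (f i) (g i)) -> eqv U (comp f a) (comp g a).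
Proof.
move=> fg.
have [c Uc cfg] : exists2 c, U c & forall i, c ⩤ f i = c ⩤ g i.
  suff [c Uc cfg] : exists2 c, U c &
      forall i, i \in enum 'I_n -> c ⩤ f i = c ⩤ g i.
    by exists c => // i; apply: cfg; rewrite mem_enum.
  elim: (enum 'I_n) => [|j s [c Uc cfg]]; first by exists o; case: Uid.
  have [d Ud dj] := fg j; exists (join c d) => [|i]; first exact: ideal_join.
  rewrite !joinE inE => /predU1P[->|/cfg e]; first by rewrite dj.
  by rewrite outC e outC.
by exists c; rewrite // !out_comp; congr comp; apply: funext.
Qed.

Lemma eqv_out a b c : eqv U b c -> eqv U (a ⩤ b) (a ⩤ c).
Proof. by case=> d Ud e; exists d; rewrite // outC e outC. Qed.

Lemma eqv_outl a b : U a -> eqv U (a ⩤ b) b.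
Proof. by move=> Ua; exists a; rewrite // outK. Qed.

End Eqv.

Section Point.

Variables (U : set A) (Upt : prime_ideal U).

Let Uid : ideal U := prime_ideal_ideal Upt.

Lemma eqv_onl a b : ~ U a -> eqv U (a ◁ b) b.
Proof. by move=> Ua; rewrite (onE i0); apply/eqv_outl/(prime_max Upt). Qed.

(** The projections are the A_i 0, and 0 belongs to every ideal. *)
Lemma prime_pi i : ~ U (anti i o).
Proof. by apply: (prime_anti Upt); case: Uid. Qed.

Lemma prime_antiP a i : U (anti i a) <-> ~ U a.
Proof.
split; last exact: (prime_max Upt).
by move=> + Ua; apply: (prime_anti Upt).
Qed.

(** At a tuple of nonzero germs, the factors <D f_j> act as the identity. *)
Lemma eqv_comp_anti (f : 'I_n -> A) a i : (forall j, ~ U (f j)) ->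
  eqv U (comp f (anti i a)) (comp f a ⩤ f i).
Proof.
move=> f0; rewrite (law_comp_anti L); apply: eqv_out.
elim: (enum 'I_n) => /= [|j s]; first exact: eqv_refl.
by apply: (eqv_trans Uid); apply: eqv_onl.
Qed.

Lemma eqv_comp_anti_in (f : 'I_n -> A) a i : (forall j, ~ U (f j)) ->
  U (comp f a) -> eqv U (comp f (anti i a)) (f i).
Proof.
move=> f0 fa; apply: (eqv_trans Uid) (eqv_comp_anti a i f0) _.
exact: eqv_outl.
Qed.

Lemma prime_comp_anti (f : 'I_n -> A) a i : (forall j, ~ U (f j)) ->
  U (comp f (anti i a)) <-> ~ U (comp f a).
Proof.
move=> f0; split=> [Ufa fa | fa].
  exact/(f0 i)/(eqv_ideal Uid (eqv_comp_anti_in i f0 fa)).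
apply: (eqv_ideal Uid (eqv_sym (eqv_comp_anti a i f0))).
apply: (ideal_out0 Uid (proj2 (prime_antiP _ i0) fa)).
by rewrite -(onE i0) on_out.
Qed.

Lemma eqv_comp_dom (f : 'I_n -> A) a i j : (forall j, ~ U (f j)) ->
  ~ U (comp f a) -> eqv U (comp f (anti i (anti j a))) (f i).
Proof.
by move=> f0 fa; apply: eqv_comp_anti_in => //; apply/prime_comp_anti.
Qed.

End Point.

(** The domains on which a and b agree: law_split glues agreement on c and on
    the part of d off c. *)
Lemma ideal_agree a b : ideal [set c | c ◁ a = c ◁ b].
Proof.
have on_o x : o ◁ x = o by rewrite -[x](law_out0 L) on_out.
split=> [|c d /= ca cda]; first by rewrite /= !on_o.
apply: (law_split L (a := c)); last by rewrite !out_onA.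
by rewrite !(onE i0 c) !out_onC -!(onE i0 c) ca.
Qed.

Lemma ideal_shift U a : ideal U -> ideal [set b | U (a ⩤ b)].
Proof.
move=> [U0 Uout]; split=> [|b c /=]; first by rewrite /= out_0.
by rewrite out_out; apply: Uout.
Qed.

(** Zorn's lemma, applied to ideals that contain J and avoid π_i = A_i 0.
    A maximal such ideal U is prime: for a outside U, the ideal of all b with
    a ⩤ b in U is larger, hence contains A_i 0, so U contains
    a ⩤ A_i 0 = A_i a. The sets ordered by inclusion are the U with J ∪ U such
    an ideal, so that the empty chain has an upper bound. *)
Lemma prime_ideal_ext J i : ideal J -> ~ J (anti i o) ->
  exists2 U, prime_ideal U & J `<=` U.
Proof.
move=> Jid J1; pose P U := ideal (J `|` U) /\ ~ (J `|` U) (anti i o).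
have [F FP Ftot|M [[Mid M1] Mmax]] := @Zorn_bigcup A P.
  split; last by case=> [//|[U FU Ui]]; apply: (proj2 (FP _ FU)); right.
  split; first by left; case: Jid.
  have chain x y : (J `|` \bigcup_(X in F) X) x ->
      (J `|` \bigcup_(X in F) X) y ->
      (J x /\ J y) \/ exists2 U, F U & (J `|` U) x /\ (J `|` U) y.
    move=> [Jx|[U FU Ux]] [Jy|[V FV Vy]]; first by left.
    - by right; exists V => //; split; [left|right].
    - by right; exists U => //; split; [right|left].
    right; have [UV|VU] := Ftot _ _ FU FV.
      by exists V => //; split; right=> //; apply: UV.
    by exists U => //; split; right=> //; apply: VU.
  move=> a b Ua Uab; have [[Ja Jab]|[U FU [Va Vab]]] := chain _ _ Ua Uab.
    by left; apply: (proj2 Jid) Jab.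
  have [Jb|Ub] := (proj2 (proj1 (FP _ FU)) _ _ Va Vab); first by left.
  by right; exists U.
pose U := J `|` M; exists U; last by move=> x; left.
have anti_in a j k : U (anti j a) -> U (anti k a).
  move=> Uja; apply: (ideal_out0 Mid Uja).
  by rewrite -onE onxanti.
split=> // [a j Ua /(anti_in _ _ i) Uia | a j nUa].
  by apply: M1; apply: (proj2 Mid) Ua _; rewrite out_anti out_0 (law_out0 L).
apply: (anti_in _ i).
apply: contrapT => nUia; pose V := [set b | U (a ⩤ b)].
have UV : U `<=` V.
  by move=> b Ub; apply: (ideal_out0 Mid Ub); rewrite outC (law_outxx L) out_0.
have JV : J `|` V = V by apply/setUidPr => x Jx; apply: UV; left.
apply: (Mmax V).
  split; first by move=> x Mx; apply: UV; right.
  move=> VM; apply: nUa; right; apply: VM.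
  by rewrite /V /= (law_outxx L); case: Mid.
rewrite /P JV; split; first exact: ideal_shift.
by rewrite /V /= out_anti out_0 (law_out0 L).
Qed.

Lemma separation a b : a <> b ->
  exists2 U, prime_ideal U & ~ eqv U a b.
Proof.
move=> ab; have [|U Upt sub] := prime_ideal_ext (i := i0) (ideal_agree a b).
  by rewrite /= -!(outE i0) !(law_out0 L).
exists U => // -[c Uc e]; apply: (prime_anti Upt (i := i0) Uc).
by apply: sub; rewrite /= -!(outE i0).
Qed.

(** * The representation on nonzero germs *)

(** A germ is a pair of a prime ideal and a class of germ equality at it. *)
Definition base : Type := {p : set A * set A |
  prime_ideal p.1 /\ exists2 a, ~ p.1 a & p.2 = eqv p.1 a}.


Definition ideal_of (x : base) : set A := (sval x).1.

Definition elt (x : base) : A := s2val (cid2 (proj2 (svalP x))).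

Lemma ideal_of_prime x : prime_ideal (ideal_of x).
Proof. exact: (proj1 (svalP x)). Qed.

Lemma elt_nonzero x : ~ ideal_of x (elt x).
Proof. exact: (s2valP (cid2 (proj2 (svalP x)))). Qed.

Lemma base_class x : (sval x).2 = eqv (ideal_of x) (elt x).
Proof. exact: (s2valP' (cid2 (proj2 (svalP x)))). Qed.

Lemma base_point U a : prime_ideal U -> ~ U a ->
  exists2 x, ideal_of x = U & eqv U a (elt x).
Proof.
move=> Upt Ua; have Uid := prime_ideal_ideal Upt.
have xP : prime_ideal U /\ exists2 b, ~ U b & eqv U a = eqv U b.
  by split; last exists a.
pose x : base := exist _ (U, eqv U a) xP; exists x => //.
apply: eqv_sym; suff : (sval x).2 a by rewrite base_class.
exact: eqv_refl.
Qed.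

Lemma base_eq x y :
  ideal_of x = ideal_of y -> eqv (ideal_of x) (elt x) (elt y) -> x = y.
Proof.
move=> xy; have Uid := prime_ideal_ideal (ideal_of_prime x).
move=> exy; have {exy} : (sval x).2 = (sval y).2.
  rewrite !base_class -xy; apply/predeqP => c; split.
    exact: (eqv_trans Uid (eqv_sym exy)).
  exact: (eqv_trans Uid exy).
move: xy; rewrite /ideal_of; case: x y {Uid} => [[U S] xP] [[V T] yP] /= UV ST.
by subst V T; congr exist; apply: Prop_irrelevance.
Qed.

Definition same_ideal (x y : base) : Prop := ideal_of x = ideal_of y.

(** Right composition on germs. That the value does not depend on the chosen
    representatives elt is eqv_comp. No condition on being nonzero appears
    since every point of the base is a nonzero germ. *)
Definition rep a : nrel n base := [set p |
  (forall i, ideal_of (p.1 i) = ideal_of p.2) /\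
  eqv (ideal_of p.2) (comp (elt \o p.1) a) (elt p.2)].

Section AtTuple.

Variables (U : set A) (x : 'I_n -> base).
Hypotheses (Upt : prime_ideal U) (xU : forall i, ideal_of (x i) = U).

Let Uid : ideal U := prime_ideal_ideal Upt.

Let x0 i : ~ U (elt (x i)).
Proof. by rewrite -(xU i); apply: elt_nonzero. Qed.

Lemma rep_def a : (exists z, rep a (x, z)) <-> ~ U (comp (elt \o x) a).
Proof.
split=> [[z [/= xz e]] Ua|/(base_point Upt) [z zU e]].
  have zU : ideal_of z = U by rewrite -(xz i0) xU.
  rewrite zU in e; apply: (@elt_nonzero z); rewrite zU.
  exact: eqv_ideal e Ua.
by exists z; split=> [i|]; rewrite /= zU.
Qed.

Lemma repE a z : ideal_of z = U ->
  rep a (x, z) <-> eqv U (comp (elt \o x) a) (elt z).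
Proof. by move=> zU; split=> [[]|]; rewrite /rep /= zU. Qed.

End AtTuple.

Lemma rep_ideal_of a x z i : rep a (x, z) -> ideal_of (x i) = ideal_of z.
Proof. by case. Qed.

(** If the composite is nonzero at x then so is each <x>; f_i, because a tuple
    with a zero entry composes to zero; hence an intermediate tuple of germs
    exists. *)
Lemma rep_comp f a : rep (comp f a) = pcomp (fun i => rep (f i)) (rep a).
Proof.
apply/predeqP => -[x z] /=.
have Upt := ideal_of_prime z; have Uid := prime_ideal_ideal Upt.
split=> [fa|[y [/= xy yz]]]; last first.
  have yU i : ideal_of (y i) = ideal_of z by case: yz.
  have xU i : ideal_of (x i) = ideal_of z by rewrite (rep_ideal_of i (xy i)).
  apply/(repE xU) => //; rewrite -(law_assoc L).
  move/(repE yU _ erefl): yz; apply: (eqv_trans Uid); apply: eqv_comp => // i.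
  exact/(repE xU).
have xU i : ideal_of (x i) = ideal_of z by case: fa.
move/(repE xU _ erefl): fa; rewrite -(law_assoc L) => fa.
have xf0 i : ~ ideal_of z (comp (elt \o x) (f i)).
  move=> /(eqv0P Uid) xf0; apply: (@elt_nonzero z).
  apply: (eqv_ideal Uid fa); apply/(eqv0P Uid).
  pose g j := if j == i then o else comp (elt \o x) (f j).
  have <- : comp g a = o by apply: (law_0comp L (i := i)); rewrite /g eqxx.
  apply: eqv_comp => // j; rewrite /g; case: eqP => [->|_] //.
  exact: eqv_refl.
have /choice[y yP] i : exists y,
    ideal_of y = ideal_of z /\
    eqv (ideal_of z) (comp (elt \o x) (f i)) (elt y).
  by have [y] := base_point Upt (xf0 i); exists y.
have yU i : ideal_of (y i) = ideal_of z by case: (yP i).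
exists y; split=> [i|]; first by apply/(repE xU) => //; case: (yP i).
apply/(repE yU) => //; apply: (eqv_trans Uid) fa; apply: eqv_comp => // i.
by apply: eqv_sym; case: (yP i).
Qed.

Lemma rep_anti i a : rep (anti i a) = panti same_ideal i (rep a).
Proof.
apply/predeqP => -[x z]; rewrite /panti /=.
set U := ideal_of (x i); have Upt : prime_ideal U := ideal_of_prime _.
have Uid := prime_ideal_ideal Upt.
have [xU|nxU] := pselect (forall j, ideal_of (x j) = U); last first.
  split=> [xz|[_ e _]]; case: nxU => j; last exact: e.
  by rewrite (rep_ideal_of j xz) -(rep_ideal_of i xz).
have x0 j : ~ U (elt (x j)) by rewrite -(xU j); apply: elt_nonzero.
split=> [xz|[-> _ nxa]].
  have xa : U (comp (elt \o x) a).
    apply: contrapT => /(prime_comp_anti Upt a i x0).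
    by apply: (proj1 (rep_def Upt xU _)); exists z.
  have zU : ideal_of z = U by rewrite -(rep_ideal_of i xz).
  split; last by move=> /(rep_def Upt xU).
    apply: esym; apply: base_eq; first exact/esym.
    move/(repE xU _ zU): xz; apply: (eqv_trans Uid); apply: eqv_sym.
    exact: eqv_comp_anti_in.
  by move=> j k; rewrite /same_ideal !xU.
apply/(repE xU) => //; apply: eqv_comp_anti_in => //.
by apply: contrapT => /(rep_def Upt xU).
Qed.

(** A fixset is its own domain, which gives the value x_i, and it restricts a,
    which shows that a takes that value. Conversely, if a takes the value x_i on
    germs, the equation <x>; a = x_i holds exactly after a suitable c ⩤ _, and
    the quasiequation for fixsets applies to the tuple of the c ⩤ x_j. *)
Lemma rep_fixset i a : rep (fixset i a) = pfixset i (rep a).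
Proof.
apply/predeqP => -[x z]; rewrite /pfixset /=.
set U := ideal_of z; have Upt : prime_ideal U := ideal_of_prime _.
have Uid := prime_ideal_ideal Upt.
have [xU|nxU] := pselect (forall j, ideal_of (x j) = U); last first.
  by split=> [xz|[_ xz]]; case: nxU => j; apply: rep_ideal_of xz.
have x0 j : ~ U (elt (x j)) by rewrite -(xU j); apply: elt_nonzero.
split=> [xz|[zx xz]]; last first.
  move/(repE xU _ erefl): xz; rewrite zx => -[c Uc e].
  apply/(repE xU) => //.
  exists c; rewrite // out_comp.
  by apply: (law_fix_val L (b := fun j => c ⩤ elt (x j))); rewrite -out_comp.
have xF0 : ~ U (comp (elt \o x) (fixset i a)).
  by apply/(rep_def Upt xU); exists z.
have xD j : eqv U (comp (elt \o x) (anti j (anti j (fixset i a)))) (elt (x j)).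
  exact: eqv_comp_dom.
move/(repE xU _ erefl): xz => xz.
have zx : z = x i.
  apply/esym/base_eq; first exact: xU.
  rewrite xU; apply: (eqv_trans Uid) xz; apply: eqv_sym.
  by rewrite -(law_fix_dom L i a).
split=> //; apply/(repE xU) => //; apply: (eqv_trans Uid) xz.
apply: eqv_sym; rewrite -(law_fix_on L i a) comp_on.
exact: eqv_comp.
Qed.

(** Composing x with D a or A a does not change its germs when <x>; a is nonzero
    or zero, respectively; so pref a b acts as its restriction to, or away
    from, the domain of a. *)
Lemma rep_pref a b : rep (pref a b) = ppref (rep a) (rep b).
Proof.
apply/predeqP => -[x z]; rewrite /ppref /=.
set U := ideal_of z; have Upt : prime_ideal U := ideal_of_prime _.
have Uid := prime_ideal_ideal Upt.
have [xU|nxU] := pselect (forall j, ideal_of (x j) = U); last first.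
  by split=> [xz|[xz|[_ xz]]]; case: nxU => j; apply: rep_ideal_of xz.
have x0 j : ~ U (elt (x j)) by rewrite -(xU j); apply: elt_nonzero.
have [xa|xa] := pselect (exists y, rep a (x, y)).
  suff e : eqv U (comp (elt \o x) a) (comp (elt \o x) (pref a b)).
    split=> [xz|[xz|[//]]].
      left; apply/(repE xU) => //; apply: (eqv_trans Uid e).
      exact/(repE xU).
    apply/(repE xU) => //; apply: (eqv_trans Uid (eqv_sym e)).
    exact/(repE xU).
  rewrite -[in X in eqv _ X _](law_pref_on L a b) comp_on.
  apply: eqv_comp => // j.
  by apply: eqv_comp_dom => //; apply/(rep_def Upt xU).
suff e : eqv U (comp (elt \o x) (pref a b)) (comp (elt \o x) b).
  split=> [xz|[xz|[_ xz]]].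
  - right; split=> //; apply/(repE xU) => //.
    by apply: (eqv_trans Uid (eqv_sym e)); apply/(repE xU).
  - by case: xa; exists z.
  - by apply/(repE xU) => //; apply: (eqv_trans Uid e); apply/(repE xU).
have xA c : eqv U (comp (elt \o x) (a ⩤ c)) (comp (elt \o x) c).
  rewrite comp_out; apply: eqv_comp => // j; apply: eqv_comp_anti_in => //.
  by apply: contrapT => /(rep_def Upt xU).
by apply: (eqv_trans Uid) (xA b); rewrite -(law_pref_out L); apply: eqv_sym.
Qed.

Lemma rep_pfun a : partial_function (rep a).
Proof.
move=> x y z xy xz; have e : ideal_of y = ideal_of z.
  by rewrite -(rep_ideal_of i0 xy) (rep_ideal_of i0 xz).
apply: base_eq => //; case: xy => _ /=; case: xz => _ /=; rewrite e => xz xy.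
exact: (eqv_trans (prime_ideal_ideal (ideal_of_prime z)) (eqv_sym xy) xz).
Qed.

Lemma rep_equiv a : entries_equiv same_ideal (rep a).
Proof.
move=> x z xz; split=> [i j|i]; last exact: rep_ideal_of xz.
by rewrite /same_ideal !(rep_ideal_of _ xz).
Qed.

(** Cancellation: from <x>; a = <y>; a up to a negligible domain follows
    <x>; D_i a = <y>; D_i a, and these have the germs of x_i and y_i. *)
Lemma rep_inj_pfun a : injective_pfun (rep a).
Proof.
move=> x y z xz yz; apply: funext => i.
have Upt := ideal_of_prime z; have Uid := prime_ideal_ideal Upt.
have xU j := rep_ideal_of j xz; have yU j := rep_ideal_of j yz.
have xa0 : ~ ideal_of z (comp (elt \o x) a) by apply/(rep_def Upt xU); exists z.
have ya0 : ~ ideal_of z (comp (elt \o y) a) by apply/(rep_def Upt yU); exists z.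
have x0 j : ~ ideal_of z (elt (x j)) by rewrite -(xU j); apply: elt_nonzero.
have y0 j : ~ ideal_of z (elt (y j)) by rewrite -(yU j); apply: elt_nonzero.
apply: base_eq; rewrite ?xU ?yU //.
apply: (eqv_trans Uid) (eqv_comp_dom Upt i i y0 ya0).
apply: (eqv_trans Uid (eqv_sym (eqv_comp_dom Upt i i x0 xa0))).
move/(repE xU _ erefl): xz => xz; move/(repE yU _ erefl): yz => yz.
have [c Uc] := eqv_trans Uid xz (eqv_sym yz).
by rewrite !out_comp => /(law_inj L i) e; exists c; rewrite // !out_comp.
Qed.

(** The germs of the projections form a tuple at which the value of any c is
    the germ of c itself. *)
Lemma rep_inj : injective rep.
Proof.
move=> a b ab; apply: contrapT => /separation[U Upt nab].
have Uid := prime_ideal_ideal Upt.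
have /choice[x xP] i : exists x, ideal_of x = U /\ eqv U (anti i o) (elt x).
  by have [x] := base_point Upt (@prime_pi _ Upt i); exists x.
have xU i : ideal_of (x i) = U by case: (xP i).
have xE c : eqv U (comp (elt \o x) c) c.
  rewrite -[X in eqv _ _ X](law_out0 L); apply: eqv_comp => // i.
  by apply: eqv_sym; case: (xP i).
have below c d : rep c = rep d -> ~ U c -> eqv U c d.
  move=> cd Uc; have [|z xz] := proj2 (rep_def Upt xU c).
    by move=> /(eqv_ideal Uid (xE c)).
  have zU : ideal_of z = U by rewrite -(xU i0) (rep_ideal_of i0 xz).
  apply: (eqv_trans Uid (eqv_sym (xE c))); apply: (eqv_trans Uid) (xE d).
  apply: (eqv_trans Uid (proj1 (repE xU _ zU) xz)); apply: eqv_sym.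
  by apply/(repE xU) => //; rewrite -cd.
have [Ua|/(below _ _ ab)//] := pselect (U a).
have [Ub|/(below _ _ (esym ab)) /eqv_sym//] := pselect (U b).
apply: nab; apply: (eqv_trans Uid) (eqv_sym (proj2 (eqv0P Uid b) Ub)).
exact/eqv0P.
Qed.

Lemma rep_universe : pfun_universe same_ideal (range rep).
Proof.
split.
- by exists (rep o); exists o.
- by move=> _ [a _ <-]; apply: rep_pfun.
- by move=> _ [a _ <-]; apply: rep_equiv.
- move=> f _ /(_ _)/cid2-/all_sig2[a _ fE] [b _ <-].
  exists (comp a b) => //; rewrite rep_comp; congr pcomp.
  exact: funext.
- by move=> i _ [a _ <-]; exists (anti i a); rewrite ?rep_anti.
- by move=> i _ [a _ <-]; exists (fixset i a); rewrite ?rep_fixset.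
- by move=> _ _ [a _ <-] [b _ <-]; exists (pref a b); rewrite ?rep_pref.
Qed.

Lemma laws_representable : injectively_representable A.
Proof.
exists base, same_ideal, (range rep), rep_universe; split.
- split=> [x //|x y xy|x y z xy yz]; first exact: esym.
  exact: etrans xy yz.
- by move=> _ [a _ <-]; apply: rep_inj_pfun.
pose h a : pfun_algebra rep_universe := exist _ (rep a) (imageT rep a).
exists h.
have valI (f g : pfun_algebra rep_universe) : sval f = sval g -> f = g.
  move: f g => [f fP] [g gP] /= fg; subst g; congr exist.
  exact: Prop_irrelevance.
split.
- have hinv (f : pfun_algebra rep_universe) : exists a, h a = f.
    by case: f => f [a aT fE]; exists a; apply: valI.
  have [g gP] := choice hinv; exists g => // a.
  by apply: rep_inj; apply: (f_equal sval (gP (h a))).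
- by move=> f a; apply: valI; apply: rep_comp.
- by move=> i a; apply: valI; apply: rep_anti.
- by move=> i a; apply: valI; apply: rep_fixset.
- by move=> a b; apply: valI; apply: rep_pref.
Qed.

End Representation.

Theorem corollary8p7 (n : nat) (hn : (1 <= n)%N) :
  quasivariety (@injectively_representable n) /\
  finitely_axiomatised_by (@injectively_representable n) (axioms n).
Proof.
have i0 : 'I_n := Ordinal hn.
suff ax : finitely_axiomatised_by (@injectively_representable n) (axioms n).
  by split=> //; exists [set q | List.In q (axioms n)].
move=> A; split=> [[X [E [F [FU [E_equiv F_inj AB]]]]] q qax|Aax].
  have [o L] := concrete_laws i0 FU E_equiv F_inj.
  by apply: satisfies_isomorphic AB _; apply: axioms_of_laws L _ qax.
have [o L] := laws_of_axioms Aax.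
exact: laws_representable L i0.
Qed.
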